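(* Let $h>0$, let $\vartheta\in[0,1)$ and let $$\Delta\tau_{\mathrm{OPT}}(\vartheta)=\arg\min_{\Delta\tau>0}\ \sup_{(\alpha_1,\alpha_2)\in\mathrm{HIGH}}\left|G(\alpha_1,\alpha_2,\vartheta,\Delta\tau)\right|$$ be the optimal relaxation parameter for Neumann boundary conditions in 3D. Then $$\frac{\Delta\tau_{\mathrm{OPT}}(\vartheta)}{h}=\frac{2}{G_0^{\min}(\vartheta)+G_0^{\max}(\vartheta)},$$ where $G_0^{\min}(\vartheta)$ and $G_0^{\max}(\vartheta)$ are respectively the minimum and the maximum of the set $$\left\{\,|G_0(\pi/2,0,\vartheta)|,\ |G_0(\pi/2,\pi/2,\vartheta)|,\ |G_0(\pi,\pi,\vartheta)|\,\right\}.$$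
   Context: Here $h>0$ is the grid spacing. Let $\mathrm{LOW}=[0,\pi/2]^2$ and $\mathrm{HIGH}=[0,\pi]^2\setminus\mathrm{LOW}$. For $(\alpha_1,\alpha_2)\in[0,\pi]^2$ put $p(\alpha_1,\alpha_2)=\cosh^{-1}(3-\cos\alpha_1-\cos\alpha_2)$, where $\cosh^{-1}:[1,\infty)\to[0,\infty)$ is the inverse of $\cosh$ on $[0,\infty)$. For $\vartheta\in[0,1)$ define the Neumann coefficients $$c_{-2}(\vartheta)=\tfrac12-\vartheta,\quad c_{-1}(\vartheta)=2(\vartheta-1),\quad c_0(\vartheta)=\tfrac32-\vartheta,$$ and set $$G_0(\alpha_1,\alpha_2,\vartheta)=\sum_{r=0}^{2}c_{-r}(\vartheta)\,e^{-r\,p(\alpha_1,\alpha_2)},\qquad G(\alpha_1,\alpha_2,\vartheta,\Delta\tau)=1-\frac{\Delta\tau}{h}\,G_0(\alpha_1,\alpha_2,\vartheta)\quad(\Delta\tau>0).$$ ($G$ is the amplification factor of the tangential Fourier mode $e^{\mathbf{i}\alpha_1 y/h}e^{\mathbf{i}\alpha_2 z/h}$ under one relaxation of the ghost values.) *)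

(* Defs.v *)
(* MathComp-Analysis, over an arbitrary R : realType. *)
From HB Require Import structures.
From mathcomp Require Import all_boot all_order all_algebra.
From mathcomp Require Import ring lra.
From mathcomp Require Import all_classical all_reals all_analysis.

Set Implicit Arguments.
Unset Strict Implicit.
Unset Printing Implicit Defensive.

Import Order.TTheory GRing.Theory Num.Theory.
Import numFieldNormedType.Exports.

Local Open Scope classical_set_scope.
Local Open Scope ring_scope.

Definition cosh (R : realType) (x : R) : R := (expR x + expR (- x)) / 2.

(* The value is 0 outside [1, +oo[; on [1, +oo[ see acosh_ge0 and acoshK. *)
Definition acosh (R : realType) : R -> R :=
  'pinv_(fun=> 0) [set x : R | 0 <= x] (@cosh R).

Lemma cosh_surj (R : realType) :
  set_surj [set x : R | 0 <= x] [set y : R | 1 <= y] (@cosh R).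
Proof.
move=> y /= y1.
set s := Num.sqrt (y ^+ 2 - 1).
have s0 : 0 <= s by exact: sqrtr_ge0.
have s2 : s ^+ 2 = y ^+ 2 - 1 by rewrite sqr_sqrtr //; nra.
have ys0 : 0 < y + s by lra.
exists (ln (y + s)); first by rewrite /= ln_ge0 //; lra.
rewrite /cosh expRN lnK ?posrE//.
have -> : (y + s)^-1 = y - s.
  apply: (mulfI (lt0r_neq0 ys0)); rewrite divff ?lt0r_neq0//.
  by rewrite mulrC -subr_sqr s2; ring.
by field.
Qed.

Lemma acosh_ge0 (R : realType) (y : R) : 1 <= y -> 0 <= acosh y.
Proof.
by move=> y1; apply: (surjpinv_image_sub (@cosh_surj R)); exists y.
Qed.

Lemma acoshK (R : realType) (y : R) : 1 <= y -> cosh (acosh y) = y.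
Proof. by move=> y1; exact: (surjpK (fun=> 0) (@cosh_surj R) (mem_set y1)). Qed.

Definition LOW (R : realType) : set (R * R) :=
  `[0, pi / 2] `*` `[0, pi / 2].
Arguments LOW R : clear implicits.

Definition HIGH (R : realType) : set (R * R) :=
  (`[0, pi] `*` `[0, pi]) `\` LOW R.
Arguments HIGH R : clear implicits.

Definition pfun (R : realType) (a1 a2 : R) : R := acosh (3 - cos a1 - cos a2).

(* neumann_coef theta r is the coefficient c_{-r}(theta). *)
Definition neumann_coef (R : realType) (theta : R) (r : 'I_3) : R :=
  match val r with
  | 0%N => 3 / 2 - theta
  | 1%N => 2 * (theta - 1)
  | _ => 1 / 2 - theta
  end.

Definition G0 (R : realType) (a1 a2 theta : R) : R :=
  \sum_(r < 3) neumann_coef theta r * expR (- r%:R * pfun a1 a2).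

Definition G (R : realType) (h a1 a2 theta dtau : R) : R :=
  1 - dtau / h * G0 a1 a2 theta.

Definition argmin (R : realType) (T : Type) (D : set T) (f : T -> \bar R) :
  set T := [set x | D x /\ forall y, D y -> (f x <= f y)%E].

(* The supremum is taken in \bar R, so it needs no boundedness proviso. *)
Definition sup_HIGH (R : realType) (h theta dtau : R) : \bar R :=
  ereal_sup [set `|G h a.1 a.2 theta dtau|%:E | a in HIGH R].

Definition G0min (R : realType) (theta : R) : R :=
  Num.min `|G0 (pi / 2) 0 theta|
    (Num.min `|G0 (pi / 2) (pi / 2) theta| `|G0 pi pi theta|).

Definition G0max (R : realType) (theta : R) : R :=
  Num.max `|G0 (pi / 2) 0 theta|
    (Num.max `|G0 (pi / 2) (pi / 2) theta| `|G0 pi pi theta|).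

(* Main.v *)
Require Import Defs.
From HB Require Import structures.
From mathcomp Require Import all_boot all_order all_algebra.
From mathcomp Require Import ring lra.
From mathcomp Require Import all_classical all_reals all_analysis.

Set Implicit Arguments.
Unset Strict Implicit.
Unset Printing Implicit Defensive.

Import Order.TTheory GRing.Theory Num.Theory.
Import numFieldNormedType.Exports.

Local Open Scope classical_set_scope.
Local Open Scope ring_scope.

(** Only the value [s = 3 - cos a1 - cos a2] matters: [G0] is
    [(1 - q) (3/2 - theta - (1/2 - theta) q)] with [q = exp (- acosh s)], the
    root in ]0, 1] of [q^2 - 2 s q + 1] ([G0E], [decay_quadratic]).  On HIGH
    at least one cosine is negative, so [s] ranges over ]2, 5]; the three points
    of the statement correspond to [s = 2, 3, 5].  Since [q] decreases with
    [s] and the polynomial above decreases on ]0, 1[, [G0] is positive and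
    nondecreasing in [s] ([neumann_symbol_gt0], [neumann_symbol_increment]).
    Hence the minimum and maximum of the three-point set are the values at
    [s = 2] and [s = 5], and they bound [G0] on HIGH.

    The value at [s = 5] is attained at (pi, pi).  The value at [s = 2] is not
    attained on HIGH, since (pi/2, 0) belongs to LOW, but it is a limit of
    values on HIGH, which is enough for a supremum of continuous functions of
    [G0].  What remains is the classical relaxation problem of minimizing
    [sup |1 - k x|] over a set of reals lying in [m, M] with [m] and [M] in its
    closure: the best [k] makes the two endpoint errors opposite,
    [1 - k m = k M - 1], that is [k = 2 / (m + M)] ([argmin_sup_norm1B]). *)

(** A bound over a set reaches its limit points; this is what lets an infimum
    that is not attained play the part of a minimum. *)
Lemma closure_norm1B_le (R : realType) (A : set R) (k B y : R) :
  (forall x, A x -> `|1 - k * x| <= B) -> closure A y -> `|1 - k * y| <= B.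
Proof.
move=> AB Ay.
have cl : closed [set x : R | `|1 - k * x| <= B].
  apply: (@preimage_closed _ _ (fun x : R => `|1 - k * x|) [set x | x <= B]).
    move=> x _; apply: cvg_norm; apply: cvgB; first exact: cvg_cst.
    by apply: cvgM; [exact: cvg_cst|exact: cvg_id].
  exact: closed_le.
by apply: cl; exact: (closureS AB).
Qed.

(** For this [k], [1 - k m] and [k M - 1] are both equal to the bound, and
    [1 - k x] is affine in [x]. *)
Lemma norm1B_equioscillation (R : realType) (m M k x : R) :
  0 < m -> m <= x <= M -> k = 2 / (m + M) ->
  `|1 - k * x| <= (M - m) / (m + M).
Proof.
move=> m0 /andP[mx xM] ->.
have mM : 0 < m + M by lra.
rewrite ler_norml; apply/andP; split; rewrite -subr_ge0.
  rewrite (_ : _ - _ = 2 * (M - x) / (m + M)); last by field; lra.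
  by rewrite divr_ge0; lra.
rewrite (_ : _ - _ = 2 * (x - m) / (m + M)); last by field; lra.
by rewrite divr_ge0; lra.
Qed.

(** A larger [k] makes the error at [M] worse and a smaller one the error at
    [m]: this gives the uniqueness of the optimal parameter. *)
Lemma norm1B_endpoints (R : realType) (m M k : R) :
  0 < m -> m <= M ->
  `|1 - k * m| <= (M - m) / (m + M) -> `|1 - k * M| <= (M - m) / (m + M) ->
  k = 2 / (m + M).
Proof.
move=> m0 mM; set r := (M - m) / (m + M).
have s0 : 0 < m + M by lra.
have rm : (2 / (m + M)) * m = 1 - r by rewrite /r; field; lra.
have rM : (2 / (m + M)) * M = 1 + r by rewrite /r; field; lra.
rewrite !ler_norml => /andP[_ km] /andP[kM _].
apply/eqP; rewrite eq_le -(ler_pM2r (lt_le_trans m0 mM)) rM.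
rewrite -[X in _ && X](ler_pM2r m0) rm; apply/andP; split; lra.
Qed.

(** The sup at [t] depends on [t / h] only, and it always dominates the errors
    at [m] and [M]; by [norm1B_endpoints] any [t] doing at least as well as the
    equioscillating parameter is that parameter. *)
Lemma argmin_sup_norm1B (R : realType) (T : Type) (D : set T) (g : T -> R)
    (h m M : R) :
  0 < h -> 0 < m -> (forall x, D x -> m <= g x <= M) ->
  closure (g @` D) m -> closure (g @` D) M ->
  argmin [set t : R | 0 < t]
    (fun t => ereal_sup [set `|1 - t / h * g x|%:E | x in D]) =
  [set h * (2 / (m + M))].
Proof.
move=> h0 m0 gmM clm clM.
have [_ [[x0 Dx0 _] _]] := clM setT filterT.
have mM : m <= M by have /andP[/le_trans] := gmM _ Dx0; exact.
have s0 : 0 < m + M by lra.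
set t0 := h * (2 / (m + M)); set f := (f in argmin _ f).
have t0h : t0 / h = 2 / (m + M) by rewrite /t0 mulrAC divff ?mul1r // lt0r_neq0.
have t0_gt0 : 0 < t0 by rewrite mulr_gt0 // divr_gt0 //; lra.
have ft0 : (f t0 <= ((M - m) / (m + M))%:E)%E.
  apply: ge_ereal_sup => _ [x Dx <-].
  by rewrite lee_fin; exact: norm1B_equioscillation (gmM _ Dx) t0h.
have opt t : (f t <= ((M - m) / (m + M))%:E)%E -> t = t0.
  move=> ft.
  have bd z : (g @` D) z -> `|1 - t / h * z| <= (M - m) / (m + M).
    move=> [x Dx <-]; rewrite -lee_fin; apply: le_trans ft.
    by apply: ereal_sup_ubound; exists x.
  have := norm1B_endpoints m0 mM (closure_norm1B_le bd clm)
    (closure_norm1B_le bd clM).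
  by rewrite -t0h => /(divIf (lt0r_neq0 h0)).
apply/seteqP; split => [t [/= _ tmin]|_ ->].
  by apply: opt; apply: le_trans ft0; exact: tmin.
split=> //= t _.
have [/opt ->//|/ltW] := leP (f t) ((M - m) / (m + M))%:E.
exact: le_trans.
Qed.

Definition decay (R : realType) (s : R) : R := expR (- acosh s).

(** [G0] as a function of [s = 3 - cos a1 - cos a2]; the factor [1 - decay s]
    is there because the three Neumann coefficients add up to 0. *)
Definition neumann_symbol (R : realType) (theta s : R) : R :=
  (1 - decay s) * (3 / 2 - theta - (1 / 2 - theta) * decay s).

Lemma G0E (R : realType) (a1 a2 theta : R) :
  G0 a1 a2 theta = neumann_symbol theta (3 - cos a1 - cos a2).
Proof.
rewrite /G0 !big_ord_recl big_ord0 /neumann_coef /= /neumann_symbol /decay.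
rewrite -/(pfun a1 a2) /bump /=.
rewrite mulN1r oppr0 mul0r expR0.
have -> : - (1 + 1)%N%:R * pfun a1 a2 = - pfun a1 a2 + - pfun a1 a2.
  by rewrite mulNr mulr_natl mulr2n opprD.
by rewrite expRD; field.
Qed.

(** This is [cosh (acosh s) = s] multiplied by [2 exp (- acosh s)]; it replaces
    every later use of [acosh]. *)
Lemma decay_quadratic (R : realType) (s : R) :
  1 <= s -> decay s ^+ 2 - 2 * s * decay s + 1 = 0.
Proof.
move=> s1; rewrite -{2}(acoshK s1) /cosh /decay expRN.
by field; rewrite lt0r_neq0 // expR_gt0.
Qed.

Lemma decay_range (R : realType) (s : R) :
  2 <= s -> 0 < decay s <= 1 / 2.
Proof.
move=> s2; have s1 : 1 <= s by lra.
have q0 : 0 < decay s by exact: expR_gt0.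
have q1 : decay s <= 1 by rewrite -expR0 ler_expR oppr_le0 acosh_ge0.
have := decay_quadratic s1; move: (decay s) q0 q1 => q q0 q1 E.
rewrite q0 /= leNgt; apply/negP => q2.
have : 0 <= (s - 2) * q by rewrite mulr_ge0; lra.
nra.
Qed.

Lemma neumann_symbol_gt0 (R : realType) (theta s : R) :
  theta < 1 -> 2 <= s -> 0 < neumann_symbol theta s.
Proof.
move=> t1 /decay_range /andP[q0 q1]; rewrite /neumann_symbol.
by apply: mulr_gt0; nra.
Qed.

(** Monotonicity, together with a Lipschitz bound that gives continuity at
    [s = 2].  With [q = decay s] and [r = decay s'], the increment is [q - r]
    times a factor [A] in [0, 2], and subtracting the two quadratic equations
    relates [q - r] to [s' - s]. *)
Lemma neumann_symbol_increment (R : realType) (theta s s' : R) :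
  0 <= theta < 1 -> 2 <= s -> s <= s' ->
  0 <= neumann_symbol theta s' - neumann_symbol theta s <= 2 * (s' - s).
Proof.
move=> /andP[t0 t1] s2 ss'.
have s'2 : 2 <= s' by lra.
have s1 : 1 <= s by lra.
have s'1 : 1 <= s' by lra.
have /andP[q0 q1] := decay_range s2; have /andP[r0 r1] := decay_range s'2.
have E := decay_quadratic s1; have E' := decay_quadratic s'1.
rewrite /neumann_symbol.
move: (decay s) (decay s') q0 q1 r0 r1 E E' => q r q0 q1 r0 r1 E E'.
have qr0 : 0 < q * r by rewrite mulr_gt0.
have qr1 : q * r <= 1 / 4 by nra.
(* The equations read 2 s = q + 1/q and 2 s' = r + 1/r; take the difference
   and multiply it by q r. *)
have key : (q - r) * (1 - q * r) = 2 * (q * r) * (s' - s) by nra.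
have qr : 0 <= q - r.
  by rewrite -(@pmulr_lge0 _ (1 - q * r)) ?key ?mulr_ge0//; lra.
have qr_le : (q - r) * (3 / 4) <= (s' - s) / 2 by nra.
(* A is 2 (1 - theta) - (1/2 - theta) (q + r), written so that its sign is
   visible. *)
set A := 2 * (1 - theta) * (1 - (q + r) / 2) + (q + r) / 2.
have A0 : 0 <= A by rewrite /A; nra.
have A2 : A <= 2 by rewrite /A; nra.
rewrite (_ : _ - _ = (q - r) * A); last by rewrite /A; field.
by rewrite mulr_ge0 //=; nra.
Qed.

Lemma HIGH_cos_bound (R : realType) (a : R * R) :
  HIGH R a -> 2 <= 3 - cos a.1 - cos a.2 <= 5.
Proof.
have pi0 := pi_gt0 R.
have neg (x : R) : 0 <= x <= pi -> pi / 2 < x -> cos x < 0.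
  move=> xpi x2; rewrite -(cos_pihalf R) ltr_cos ?in_itv //=.
  by apply/andP; split; lra.
case: a => a1 a2 [] /=; rewrite /LOW /= !in_itv /= => -[h1 h2] nlow.
have := cos_le1 a1; have := cos_le1 a2.
have := cos_geN1 a1; have := cos_geN1 a2.
have [x1|/(neg _ h1)] := leP a1 (pi / 2); last by lra.
have [x2|/(neg _ h2)] := leP a2 (pi / 2); last by lra.
case: nlow; split; lra.
Qed.

(** These points have [s = 2 + d], so they realize values of [s] as close to 2
    as desired. *)
Lemma HIGH_acos (R : realType) (d : R) :
  0 < d <= 1 -> HIGH R (acos (- d), 0).
Proof.
move=> /andP[d0 d1]; have pi0 := pi_gt0 R.
have d11 : -1 <= - d <= 1 by apply/andP; split; lra.
have dI : - d \in `[-1, 1] by rewrite in_itv.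
have aI : 0 <= acos (- d) <= pi by rewrite acos_ge0 ?acos_lepi.
rewrite /HIGH /LOW /= !in_itv /= aI lexx (ltW pi0); split=> //.
move=> [/andP[_ a2] _]; have := acosK dI; apply/eqP.
rewrite gt_eqF // (lt_le_trans (y := 0)) ?oppr_lt0 //.
by rewrite cos_ge0_pihalf // a2 andbT; lra.
Qed.

Theorem proposition4 (R : realType) (h theta : R)
    (h_gt0 : 0 < h) (theta_ge0 : 0 <= theta) (theta_lt1 : theta < 1) :
  exists dtau_opt : R,
    argmin [set t : R | 0 < t] (sup_HIGH h theta) = [set dtau_opt] /\
    dtau_opt / h = 2 / (G0min theta + G0max theta).
Proof.
have th : 0 <= theta < 1 by rewrite theta_ge0.
have pi0 := pi_gt0 R.
set g := neumann_symbol theta.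
have gmono s s' : 2 <= s -> s <= s' -> g s <= g s'.
  move=> s2 ss'; rewrite -subr_ge0.
  by have /andP[] := neumann_symbol_increment th s2 ss'.
have g0 s : 2 <= s -> 0 < g s by exact: neumann_symbol_gt0.
have E2 : `|G0 (pi / 2) 0 theta| = g 2.
  rewrite G0E cos_pihalf cos0 (_ : 3 - 0 - 1 = 2); last by ring.
  by rewrite ger0_norm // ltW // g0; lra.
have E3 : `|G0 (pi / 2) (pi / 2) theta| = g 3.
  by rewrite G0E cos_pihalf !subr0 ger0_norm // ltW // g0; lra.
have E5 : `|G0 pi pi theta| = g 5.
  rewrite G0E cospi (_ : 3 - -1 - -1 = 5); last by ring.
  by rewrite ger0_norm // ltW // g0; lra.
have le23 : g 2 <= g 3 by apply: gmono; lra.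
have le35 : g 3 <= g 5 by apply: gmono; lra.
have -> : G0min theta = g 2 by rewrite /G0min E2 E3 E5 (min_l le35) min_l.
have -> : G0max theta = g 5.
  by rewrite /G0max E2 E3 E5 (max_r le35) max_r // (le_trans le23).
exists (h * (2 / (g 2 + g 5))); split; last first.
  by rewrite mulrAC divff ?mul1r // lt0r_neq0.
apply: (@argmin_sup_norm1B _ _ (HIGH R) (fun a => G0 a.1 a.2 theta)) => //.
- by apply: g0; lra.
- move=> a /HIGH_cos_bound /andP[s2 s5].
  by rewrite G0E; apply/andP; split; apply: gmono.
(* The value at s = 2 is approached through s = 2 + d, where the Lipschitz
   bound gives a distance of at most 2 d < e. *)
- move=> B /nbhs_ballP[e /= e0 Be].
  pose d := Num.min 1 (e / 3).
  have d0 : 0 < d by rewrite lt_min ltr01 divr_gt0.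
  have d1 : d <= 1 by rewrite ge_min lexx.
  have de : 3 * d <= e.
    by rewrite mulrC -ler_pdivlMr // ge_min lexx orbT.
  exists (g (2 + d)); split.
    exists (acos (- d), 0); first by apply: HIGH_acos; rewrite d0.
    rewrite /= G0E cos0 acosK ?in_itv /=; last by apply/andP; split; lra.
    by congr neumann_symbol; ring.
  apply: Be; rewrite /ball /= distrC.
  have /andP[i0 i1] : 0 <= g (2 + d) - g 2 <= 2 * (2 + d - 2).
    by apply: neumann_symbol_increment => //; lra.
  by rewrite ger0_norm //; lra.
- apply: subset_closure; exists (pi, pi).
    rewrite /HIGH /LOW /= !in_itv /= lexx (ltW pi0); split=> //.
    by move=> [] /andP[_]; lra.
  by rewrite G0E /= cospi; congr neumann_symbol; ring.
Qed.
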